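(* The extremal function $F_n$ of the extremal problem is constant if and only if $D_n^\infty=\sum_{k=1}^n\chi_{\{\mathbf c_k\}}$ for points $\mathbf c_1,\dots,\mathbf c_n$ such that $x_*,\mathbf c_1,\dots,\mathbf c_n$ lie in $n+1$ pairwise distinct gaps of $\mathsf E$. (In particular, if $d_n=D_n^\infty(x_* )>0$, $F_n$ is nonconstant.)
   Context: Let $\mathsf E\subset\overline{\mathbb R}$ be a compact proper subset with infinitely many points; gaps are the connected components of $\overline{\mathbb R}\setminus\mathsf E$. Divisors are finitely supported $D:\overline{\mathbb C}\to\mathbb Z$; for rational $f$, $(f)_\infty$ is its polar divisor ($0$ for constants); $\mathcal L(D)=\{f\text{ rational}:(f)_\infty\le D\}$. For $\mathbf c\in\overline{\mathbb R}$, $r(z,\mathbf c)=1/(\mathbf c-z)$ if $\mathbf c\neq\infty$, $r(z,\infty)=z$. Fix $n\ge1$, an integral divisor $D_n^\infty\ge0$ of degree $n$ supported in $\overline{\mathbb R}\setminus\mathsf E$, and $x_*\in\overline{\mathbb R}\setminus\mathsf E$; $d_n=D_n^\infty(x_* )$, $\mathcal L_n=\mathcal L(D_n^\infty)$. The extremal problem maximizes $\Re\lim_{x\to x_*}F(x)/r(x,x_* )^{d_n}$ over $F\in\mathcal L_n$ with $\sup_{\mathsf E}|F|\le1$; its maximizer exists and is unique and is denoted $F_n$. *)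

(* Defs.v *)
From mathcomp Require Import all_boot all_order all_algebra.
From mathcomp Require Import complex.
Set Implicit Arguments. Unset Strict Implicit. Unset Printing Implicit Defensive.
Import Order.TTheory GRing.Theory Num.Theory.
Local Open Scope ring_scope.
Local Open Scope complex_scope.

Section Defs.
Variable R : rcfType.

(* Extended real line  \bar R = R u {oo}  is  option R  (None = oo).
   Riemann sphere \bar C = C u {oo}  is  option R[i]  (None = oo). *)

(* E  is a compact subset of \bar R (one-point compactification of R):
   its finite part is closed in R, and if oo is not in E it is bounded. *)
Definition ext_compact (E : option R -> Prop) : Prop :=
  (forall x : R, (forall eps : R, 0 < eps ->
       exists y : R, E (Some y) /\ `|y - x| < eps) -> E (Some x)) /\
  (~ E None -> exists M : R, forall x : R, E (Some x) -> `|x| <= M).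

Definition ext_infinite (E : option R -> Prop) : Prop :=
  ~ exists s : seq (option R), forall z, E z -> z \in s.

Definition ext_proper (E : option R -> Prop) : Prop := exists z, ~ E z.

(* The two closed arcs of the circle \bar R joining a and b. *)
Definition arc1 (a b z : option R) : Prop :=
  match a, b, z with
  | Some a, Some b, Some z => Num.min a b <= z <= Num.max a b
  | Some a, None, Some z => a <= z
  | None, Some b, Some z => b <= z
  | _, _, None => b = None \/ a = None
  | None, None, Some _ => False
  end.
Definition arc2 (a b z : option R) : Prop :=
  match a, b, z with
  | Some a, Some b, Some z => z <= Num.min a b \/ Num.max a b <= z
  | Some a, None, Some z => z <= a
  | None, Some b, Some z => z <= b
  | _, _, None => True
  | None, None, Some _ => False
  end.

(* a and b lie in the same gap (connected component of \bar R \ E):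
   both are outside E and one of the arcs joining them avoids E. *)
Definition same_gap (E : option R -> Prop) (a b : option R) : Prop :=
  ~ E a /\ ~ E b /\
  ((forall z, arc1 a b z -> ~ E z) \/ (forall z, arc2 a b z -> ~ E z)).

(* An integral divisor D >= 0 supported in \bar R is given by the finite
   multiset (sequence) of its points; D(z) = multiplicity of z. *)
Definition divv (Ds : seq (option R)) (z : option R) : nat := count_mem z Ds.

Definition divC (Ds : seq (option R)) (z : option R[i]) : nat :=
  match z with
  | None => divv Ds None
  | Some c => if complex.Im c == 0 then divv Ds (Some (complex.Re c)) else 0%N
  end.

(* A rational function is represented as p/q with q != 0, p,q coprime.
   Order of the pole of p/q at a point of the Riemann sphere. *)
Definition pole_ord (p q : {poly R[i]}) (z : option R[i]) : nat :=
  if p == 0 then 0%N else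
  match z with
  | Some a => (mup a q - mup a p)%N
  | None => (size p - size q)%N
  end.

Definition is_ratfun (p q : {poly R[i]}) : Prop := q != 0 /\ coprimep p q.

Definition in_L (Ds : seq (option R)) (p q : {poly R[i]}) : Prop :=
  forall z, (pole_ord p q z <= divC Ds z)%N.

(* value of p/q at a point of \bar R (at oo: the limit, when finite) *)
Definition rval (p q : {poly R[i]}) (z : option R) : R[i] :=
  match z with
  | Some x => p.[x%:C] / q.[x%:C]
  | None => if (size p < size q)%N then 0
            else if size p == size q then lead_coef p / lead_coef q else 0
  end.

Definition rker (c : option R) (x : R) : R[i] :=
  match c with
  | Some c => (c%:C - x%:C)^-1
  | None => x%:C
  end.

Definition has_lim (f : R -> R[i]) (c : option R) (l : R[i]) : Prop :=
  forall eps : R, 0 < eps ->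
  match c with
  | Some a => exists delta : R, 0 < delta /\
      forall x : R, x != a -> `|x - a| < delta -> `|f x - l| < eps%:C
  | None => exists M : R,
      forall x : R, M < `|x| -> `|f x - l| < eps%:C
  end.

Definition admissible (E : option R -> Prop) (Ds : seq (option R))
  (p q : {poly R[i]}) : Prop :=
  is_ratfun p q /\ in_L Ds p q /\ (forall z, E z -> `|rval p q z| <= 1).

Definition functional_lim (Ds : seq (option R)) (xs : option R)
  (p q : {poly R[i]}) (l : R[i]) : Prop :=
  has_lim (fun x => rval p q (Some x) / rker xs x ^+ divv Ds xs) xs l.

Definition is_extremal (E : option R -> Prop) (Ds : seq (option R))
  (xs : option R) (p q : {poly R[i]}) : Prop :=
  admissible E Ds p q /\
  exists lF, functional_lim Ds xs p q lF /\
    forall p' q' l, admissible E Ds p' q' -> functional_lim Ds xs p' q' l ->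
      complex.Re l <= complex.Re lF.

End Defs.

(* Main.v *)
(* A function of L(D) is P/Q with Q the form vanishing on D and P any form of
   degree n, and everything is computed with forms on the projective line.

   If the gaps of xs, c_1, .., c_n are distinct, use the affine coordinate w
   with pole at xs and order the c_k by w.  There are points e_0, .., e_n of E
   with e_0 < c_1 < e_1 < ... < c_n < e_n, and Lagrange interpolation at the e_j
   gives F(xs) = sum_j lambda_j F(e_j) with
   lambda_j = prod_k (w(e_j) - w(c_k)) / prod_{i <> j} (w(e_j) - w(e_i)) > 0
   and sum_j lambda_j = 1.  Since Re F(xs) >= 1, each F(e_j) is 1, and F - 1
   has n + 1 zeros.

   Conversely, a constant is beaten by eps w^d, with w of pole xs, if
   d = D(xs) > 0.  Otherwise it is beaten by 1 + eps g, where g is <= 0 on E and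
   positive at xs; with w of pole c_1, and d the distance from w(xs) to w(E),
   g is +-(w - w(xs)) + d if c_1 and xs share a gap, d^2 - (w - w(xs))^2 if
   c_1 is a double point, and (d^2 - (w - w(xs))^2) / +-(w(c_2) - w) if c_1
   and c_2 share a gap. *)
Require Import Defs.
From mathcomp Require Import all_boot all_order all_algebra.
From mathcomp Require Import complex.
From mathcomp Require Import ring lra zify.
From Stdlib Require Import Classical.
Import Order.TTheory GRing.Theory Num.Theory.
Local Open Scope ring_scope.

Section Extremal.
Set Implicit Arguments. Unset Strict Implicit. Unset Printing Implicit Defensive.
Local Open Scope complex_scope.
Variable R : rcfType.
Implicit Types (Ds : seq (option R)) (E : option R -> Prop).
Implicit Types (p q P Q T : {poly R[i]}) (a b c z : option R).

(** * Forms on the projective line *)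

(* The homogeneous value of P as a form of degree n at a point of the
   projective line, whose point at infinity is [None]. *)
Definition hval n P z : R[i] :=
  match z with Some x => P.[x%:C] | None => P`_n end.

(** As a form of degree 1, the constant 1 vanishes exactly at infinity, because its coefficient of
    degree 1 is 0. *)
Definition lin a : {poly R[i]} :=
  match a with Some u => 'X - u%:C%:P | None => 1 end.

(* The bracket of two projective points, i.e. the homogeneous value at z of
   the linear form vanishing at a. *)
Definition br z a : R :=
  match z, a with
  | Some x, Some u => x - u
  | None, None => 0
  | _, _ => 1
  end.

Definition linprod Ds : {poly R[i]} := \prod_(c <- Ds) lin c.

Lemma hval1_lin a z : hval 1 (lin a) z = (br z a)%:C.
Proof.
case: a z => [u|] [x|] //=; rewrite ?hornerE ?coefB ?coefX ?coefC ?rmorphB //=.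
by rewrite subr0.
Qed.

Lemma hvalD n P Q z : hval n (P + Q) z = hval n P z + hval n Q z.
Proof. by case: z => [x|] /=; rewrite ?hornerD ?coefD. Qed.

Lemma hvalN n P z : hval n (- P) z = - hval n P z.
Proof. by case: z => [x|] /=; rewrite ?hornerN ?coefN. Qed.

Lemma hvalZ n k P z : hval n (k *: P) z = k * hval n P z.
Proof. by case: z => [x|] /=; rewrite ?hornerZ ?coefZ. Qed.

Lemma hval_sum n I (s : seq I) (f : I -> {poly R[i]}) z :
  hval n (\sum_(i <- s) f i) z = \sum_(i <- s) hval n (f i) z.
Proof. by case: z => [x|] /=; rewrite ?horner_sum ?coef_sum. Qed.

Lemma coefM_top (m k : nat) P Q : (size P <= m.+1)%N -> (size Q <= k.+1)%N ->
  (P * Q)`_(m + k) = P`_m * Q`_k.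
Proof.
move=> sP sQ; rewrite coefM.
have lt_m : (m < (m + k).+1)%N by rewrite ltnS leq_addr.
rewrite (bigD1 (Ordinal lt_m)) //= addKn big1 ?addr0 // => i.
rewrite -val_eqE /= neq_ltn => /orP[lt_im|lt_mi].
  by rewrite [Q`_ _]nth_default ?mulr0 // (leq_trans sQ) // ltn_subRL ltn_add2r.
by rewrite [P`_ _]nth_default ?mul0r // (leq_trans sP).
Qed.

(** At infinity this is the product of the coefficients in the formal top degrees [m] and [k]. These
    may vanish, so only upper bounds on the sizes are asked for. *)
Lemma hvalM (m k : nat) P Q z : (size P <= m.+1)%N -> (size Q <= k.+1)%N ->
  hval (m + k) (P * Q) z = hval m P z * hval k Q z.
Proof. by case: z => [x|] sP sQ /=; rewrite ?hornerM ?coefM_top. Qed.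

Lemma size_lin a : (size (lin a) <= 2)%N.
Proof. by case: a => [u|] /=; rewrite ?size_XsubC ?size_poly1. Qed.

Lemma linprod_cons c Ds : linprod (c :: Ds) = lin c * linprod Ds.
Proof. by rewrite /linprod big_cons. Qed.

Lemma size_mul_leqD (m k : nat) P Q : (size P <= m.+1)%N -> (size Q <= k.+1)%N ->
  (size (P * Q)%R <= (m + k).+1)%N.
Proof. by move=> sP sQ; apply: leq_trans (size_polyMleq _ _) _; lia. Qed.

Lemma size_prod_lin I (s : seq I) (f : I -> {poly R[i]}) :
  (forall i, size (f i) <= 2)%N -> (size (\prod_(i <- s) f i)%R <= (size s).+1)%N.
Proof.
move=> sf; elim: s => [|i s IH]; first by rewrite big_nil size_poly1.
by rewrite big_cons; apply: (@size_mul_leqD 1 (size s)).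
Qed.

Lemma hval_prod_lin I (s : seq I) (f : I -> {poly R[i]}) z :
  (forall i, size (f i) <= 2)%N ->
  hval (size s) (\prod_(i <- s) f i) z = \prod_(i <- s) hval 1 (f i) z.
Proof.
move=> sf; elim: s => [|i s IH].
  by rewrite !big_nil; case: z => [x|] /=; rewrite ?hornerE ?coefC.
by rewrite !big_cons /= -add1n hvalM ?size_prod_lin // IH.
Qed.

Lemma size_linprod Ds : (size (linprod Ds) <= (size Ds).+1)%N.
Proof. exact/size_prod_lin/size_lin. Qed.

Lemma hval_linprod Ds z :
  hval (size Ds) (linprod Ds) z = (\prod_(c <- Ds) br z c)%:C.
Proof.
rewrite hval_prod_lin ?rmorph_prod; last exact: size_lin.
by apply: eq_bigr => c _; rewrite hval1_lin.
Qed.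

Lemma br_eq0 z a : (br z a == 0) = (z == a).
Proof.
by case: z a => [x|] [u|] //=; rewrite ?subr_eq0 ?oner_eq0 ?eqxx.
Qed.

Lemma hval_linprod_neq0 Ds z :
  z \notin Ds -> hval (size Ds) (linprod Ds) z != 0.
Proof.
move=> zDs; rewrite hval_linprod fmorph_eq0.
rewrite prodf_seq_neq0; apply/allP => c cDs /=; rewrite br_eq0.
by apply: contraNneq zDs => ->.
Qed.

Definition toC (x : R) : R[i] := x%:C.

Lemma linprodE Ds : linprod Ds = \prod_(y <- map toC (pmap id Ds)) ('X - y%:P).
Proof.
elim: Ds => [|[u|] Ds IH]; rewrite ?linprod_cons ?[linprod [::]]big_nil ?big_nil //=.
  by rewrite big_cons IH.
by rewrite mul1r.
Qed.

Lemma linprod_neq0 Ds : linprod Ds != 0.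
Proof. by rewrite linprodE monic_neq0 ?monic_prod_XsubC. Qed.

Lemma size_pmap_id (s : seq (option R)) :
  (size (pmap id s) + count_mem None s = size s)%N.
Proof. by elim: s => [|[u|] s IH] //=; rewrite ?addnS ?addSn IH. Qed.

(** Each occurrence of infinity in [Ds] contributes the factor 1 and so lowers the degree by one. *)
Lemma size_linprodE Ds : (size (linprod Ds) + divv Ds None = (size Ds).+1)%N.
Proof. by rewrite linprodE size_prod_XsubC size_map addSn size_pmap_id. Qed.

Lemma mup_linprod Ds (x : R[i]) : mup x (linprod Ds) = divC Ds (Some x).
Proof.
rewrite linprodE mu_prod_XsubC /= /divv.
elim: Ds => [|[u|] Ds IH] /=; first by case: ifP.
  rewrite IH eq_complex /= (eq_sym 0).
  by case: ifP; rewrite ?andbF ?andbT.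
by rewrite IH; case: ifP.
Qed.

(** * Functions of L(D) as quotients of forms *)

Lemma ratfun0_size q : coprimep 0 q -> size q = 1%N.
Proof. by rewrite coprime0p => /eqp_size ->; rewrite size_poly1. Qed.

(** By coprimality the multiplicity of a root of [q] is the order of a pole, so [q] divides
    [linprod Ds], and [P] is [p] times the cofactor. The condition at infinity becomes the bound on
    the size of [P]. *)
Lemma in_L_repr Ds p q : is_ratfun p q -> in_L Ds p q ->
  exists2 P : {poly R[i]}, (size P <= (size Ds).+1)%N & p * linprod Ds = P * q.
Proof.
move=> [q0 cpq] inL.
have [p0|p0] := eqVneq p 0.
  by exists 0; rewrite ?size_poly0 // p0 !mul0r.
have mupq (x : R[i]) : (mup x q <= divC Ds (Some x))%N.
  have := inL (Some x); rewrite /pole_ord (negbTE p0).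
  have [qx|nqx] := boolP (root q x); last by rewrite mupNroot.
  rewrite [mup x p]mupNroot ?subn0 //; move: qx; apply: contraL => px.
  by move/coprimep_root: cpq => /(_ x px).
have /dvdpP [g Qg] : q %| linprod Ds.
  have [rs qE] := closed_field_poly_normal q.
  (* The roots [rs] of [q], with multiplicity, form a sub-multiset of the finite points of [Ds];
     divisibility follows. *)
  have rs_le (x : R[i]) : (count_mem x rs <= count_mem x (map toC (pmap id Ds)))%N.
    rewrite -!mu_prod_XsubC -linprodE mup_linprod -(mupMr _ (q1 := (lead_coef q)%:P)).
      by rewrite mul_polyC -qE.
    by rewrite rootC lead_coef_eq0.
  have /count_subseqP [s ss ps] := rs_le.
  rewrite qE dvdpZl ?lead_coef_eq0 // (perm_big _ ps) linprodE /=.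
  have [u pu] := perm_to_subseq ss.
  by rewrite [X in _ %| X](perm_big _ pu) /= big_cat dvdp_mulr.
exists (p * g); last by rewrite Qg mulrA.
have g0 : g != 0 by apply: contraNneq (linprod_neq0 Ds) => g0; rewrite Qg g0 mul0r.
have := inL None; rewrite /pole_ord (negbTE p0) /=.
have := size_linprodE Ds; rewrite Qg !size_mul //.
move: p0 q0 g0; rewrite -!size_poly_gt0; move: (size p) (size q) (size g) (size Ds) (divv Ds None); lia.
Qed.

(** Cancelling the gcd of [P] and [linprod Ds] gives the coprime pair; cancellation can only lower
    the pole orders. *)
Lemma in_L_make Ds P : (size P <= (size Ds).+1)%N ->
  exists p q, [/\ is_ratfun p q, in_L Ds p q & p * linprod Ds = P * q].
Proof.
move=> sP; set Q := linprod Ds; have Q0 : Q != 0 by exact: linprod_neq0.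
set g := gcdp P Q; have g0 : g != 0 by rewrite gcdp_eq0 negb_and Q0 orbT.
have PE : P %/ g * g = P by rewrite divpK ?dvdp_gcdl.
have QE : Q %/ g * g = Q by rewrite divpK ?dvdp_gcdr.
have q0 : Q %/ g != 0 by apply: contraNneq Q0 => q0; rewrite -QE q0 mul0r.
exists (P %/ g), (Q %/ g); split.
- by split=> //; apply: coprimep_div_gcd; rewrite Q0 orbT.
- move=> z; rewrite /pole_ord; case: eqP => // /eqP p0.
  case: z => [x|].
    rewrite -mup_linprod (leq_trans (leq_subr _ _)) // -/Q -[in leqRHS]QE mupM //.
    exact: leq_addr.
  have := size_linprodE Ds; rewrite -/Q -[in LHS]QE size_mul //= => sQ.
  move: sP; rewrite -[in X in (X <= _)%N]PE size_mul //.
  move: p0 q0 g0 sQ; rewrite -!size_poly_gt0.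
  move: (size (P %/ g)) (size (Q %/ g)) (size g) (size Ds) (divv Ds None); lia.
- by rewrite -[in LHS]QE -[in RHS]PE; ring.
Qed.

Lemma rval_hval p q z : (size p <= size q)%N -> q != 0 ->
  rval p q z = hval (size q).-1 p z / hval (size q).-1 q z.
Proof.
case: z => [x|] //= spq q0; rewrite -/(lead_coef q).
case: ltngtP spq => // [lt_pq|eq_pq] _.
  by rewrite nth_default ?mul0r //; move: q0; rewrite -size_poly_gt0; lia.
by rewrite -eq_pq.
Qed.

Section Form.
Variables (Ds : seq (option R)) (p q P : {poly R[i]}) (z : option R).
Hypotheses (pq : is_ratfun p q) (eqPQ : p * linprod Ds = P * q).
Hypotheses (sP : (size P <= (size Ds).+1)%N) (zDs : z \notin Ds).

Lemma form_factor : exists2 g : {poly R[i]}, linprod Ds = q * g & P = p * g.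
Proof.
have [q0 cpq] := pq.
have /dvdpP [g Qg] : q %| linprod Ds.
  by rewrite -(Gauss_dvdpr _ (q := p)) 1?coprimep_sym // eqPQ dvdp_mulIr.
exists g; first by rewrite mulrC.
by apply: (mulIf q0); rewrite -eqPQ Qg; ring.
Qed.

(* Away from the poles at infinity the numerator has at most the degree of
   the denominator. *)
Lemma form_size : z = None -> (size p <= size q)%N.
Proof.
move=> z0; move: zDs; rewrite z0 => nDs; have [q0 _] := pq.
have [g Qg Pg] := form_factor.
have [->|p0] := eqVneq p 0; first by rewrite size_poly0.
have g0 : g != 0 by apply: contraNneq (linprod_neq0 Ds) => g0; rewrite Qg g0 mulr0.
have dN : divv Ds None = 0%N by rewrite /divv; apply/count_memPn.
have := size_linprodE Ds; rewrite dN addn0 Qg size_mul // => sQ.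
move: sP; rewrite Pg size_mul //.
move: p0 q0 g0 sQ; rewrite -!size_poly_gt0.
move: (size p) (size q) (size g) (size Ds); lia.
Qed.

Lemma form_denom_neq0 : hval (size q).-1 q z != 0.
Proof.
have [q0 _] := pq; have [g Qg Pg] := form_factor.
have := hval_linprod_neq0 zDs; case: z => [x|] /=.
  by rewrite Qg hornerM mulf_eq0 negb_or => /andP[].
by rewrite -lead_coefE lead_coef_eq0.
Qed.

Lemma rval_form :
  rval p q z = hval (size Ds) P z / hval (size Ds) (linprod Ds) z.
Proof.
have [q0 _] := pq; have [g Qg Pg] := form_factor.
have := hval_linprod_neq0 zDs; have := form_size.
case: (z) => [x|] spq Qz.
  move: Qz; rewrite /= Qg Pg !hornerM mulf_eq0 negb_or => /andP[qx gx].
  by rewrite invfM mulrACA mulfV ?mulr1.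
rewrite rval_hval ?spq //.
have g0 : g != 0 by apply: contraNneq (linprod_neq0 Ds) => g0; rewrite Qg g0 mulr0.
(* As infinity is not in [Ds], the form [linprod Ds] has full degree, so the degrees of [q] and [g]
   add up to [size Ds] and [hvalM] applies. *)
have sD : (size Ds = (size q).-1 + (size g).-1)%N.
  have sz : size (linprod Ds) = (size Ds).+1.
    apply/eqP; rewrite eqn_leq size_linprod ltnNge; apply: contra Qz => sQ /=.
    by rewrite nth_default.
  move: sz; rewrite Qg size_mul //; move: q0 g0; rewrite -!size_poly_gt0.
  by move: (size q) (size g) (size Ds); lia.
move: Qz; rewrite sD Qg Pg !hvalM ?(leq_trans (spq _)) //; try exact: leqSpred.
by rewrite mulf_eq0 negb_or => /andP[qx gx]; rewrite invfM mulrACA mulfV ?mulr1.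
Qed.

End Form.

(** * Affine coordinates with a prescribed pole *)

(* The affine coordinate on the real projective line with pole at b; the value
   at b itself is junk. *)
Definition wc b z : R :=
  match b, z with
  | None, Some x => x
  | Some y, Some x => (y - x)^-1
  | _, None => 0
  end.

(* The linear form which is the numerator of [wc b]. *)
Definition wpol b : {poly R[i]} := if b is Some _ then -1 else 'X.

(** The sign in [br_wc]: the bracket is antisymmetric on finite points, but equals 1 in both orders
    when exactly one point is infinite. *)
Definition wsign b : R := if b is Some _ then -1 else 1.

Lemma size_wpol b : (size (wpol b) <= 2)%N.
Proof. by case: b => [u|] /=; rewrite ?size_polyN ?size_poly1 ?size_polyX. Qed.

Lemma Some_neq (x y : R) : Some x <> Some y -> y - x != 0.
Proof. by move=> n; rewrite subr_eq0; apply/eqP => e; case: n; rewrite e. Qed.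

Lemma hval1_wpol b z : z <> b -> hval 1 (wpol b) z = (wc b z * br z b)%:C.
Proof.
case: b z => [y|] [x|] //= nxy; rewrite ?hornerE ?coefN ?coefX ?coef1 ?mulr0 ?mulr1 ?oppr0 //.
have yx := Some_neq nxy.
by rewrite -(opprB y x) mulrN mulVf // rmorphN.
Qed.

Lemma wsign_neq0 b : wsign b != 0.
Proof. by case: b => [u|] /=; rewrite ?oppr_eq0 oner_eq0. Qed.

(* A Pluecker relation: it turns brackets into differences of affine
   coordinates. *)
Lemma br_wc b e c : e <> b -> c <> b ->
  br e c = wsign b * br b c * br e b * (wc b e - wc b c).
Proof.
by case: b e c => [y|] [x|] [u|] //= =>
  [/Some_neq n1 /Some_neq n2|/Some_neq n1 _|_ /Some_neq n2|_ _|_ _];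
  field; rewrite ?n1 ?n2.
Qed.

Lemma wc_inj b e c : e <> b -> c <> b -> wc b e = wc b c -> e = c.
Proof.
move=> eb cb eqw; apply/eqP; rewrite -br_eq0 (br_wc eb cb) eqw subrr mulr0 //.
Qed.

(** * Bounds and separation on E *)

Lemma closed_sep E (y : R) : ext_compact E -> ~ E (Some y) ->
  exists2 d : R, 0 < d & forall x, E (Some x) -> d <= `|x - y|.
Proof.
move=> [clE _] nEy; apply: NNPP => H; apply: nEy; apply: clE => eps eps0.
apply: NNPP => H2; apply: H; exists eps => // x Ex; rewrite leNgt; apply/negP => lt.
by apply: H2; exists x.
Qed.

(** Compactness in bracket form: a function whose only possible pole is [c], outside E, is bounded
    on E. For finite [c] the denominator is bounded away from 0; for infinite [c] the set E itself
    is bounded. *)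
Lemma br_ratio_bounded E c a : ext_compact E -> ~ E c ->
  exists2 B : R, 0 < B & forall z, E z -> `|br z a / br z c| <= B.
Proof.
move=> cE nEc; case: c nEc => [y|] nEc.
  have [d d0 dE] := closed_sep cE nEc.
  pose k := if a is Some u then `|y - u| else 1.
  have k0 : 0 <= k by rewrite /k; case: (a).
  have kd0 : 0 <= k / d by rewrite divr_ge0 // ltW.
  exists (1 + k / d) => [|z Ez]; first by lra.
  case: z Ez => [x|] Ez; last first.
    by case: (a) => [u|]; rewrite /= ?mul0r ?normr0 ?divr1 ?normr1; lra.
  have dx := dE x Ez; have x0 : 0 < `|x - y| by apply: lt_le_trans dx.
  have xy : x - y != 0 by rewrite -normr_gt0.
  have kle : k / `|x - y| <= k / d by rewrite ler_wpM2l // lef_pV2.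
  move: k0 kd0 kle; rewrite /k; case: (a) => [u|] k0 kd0 kle /=; last first.
    by rewrite normrM normr1 normfV; apply: le_trans kle _; lra.
  have -> : (x - u) / (x - y) = 1 + (y - u) / (x - y) by field.
  apply: le_trans (ler_normD _ _) _; rewrite normr1 normrM normfV lerD2l //.
have [M ME] := cE.2 nEc.
pose k := if a is Some u then `|u| else 1.
have k0 : 0 <= k by rewrite /k; case: (a).
exists (1 + `|M| + k) => [|z Ez]; first by have := normr_ge0 M; lra.
case: z Ez => [x|] Ez //; have := ME x Ez; have := ler_norm M; have := normr_ge0 M.
rewrite /k; case: a {k k0} => [u|] /= *; rewrite divr1 ?normr1; last by lra.
by apply: le_trans (ler_normB _ _) _; lra.
Qed.

(** By [br_wc], the reciprocal of [wc c e - wc c x] is a constant times [br e c / br e x], whose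
    pole [x] is outside E. An upper bound of this ratio gives the separation. *)
Lemma wc_sep E c x : ext_compact E -> ~ E c -> ~ E x -> x <> c ->
  exists2 d : R, 0 < d & forall e, E e -> d <= `|wc c e - wc c x|.
Proof.
move=> cE nEc nEx xc; have [B B0 BE] := br_ratio_bounded c cE nEx.
have k0 : 0 < `|br c x| by rewrite normr_gt0 br_eq0; apply/eqP => e; apply: xc.
exists (`|br c x| * B)^-1 => [|e Ee]; first by rewrite invr_gt0 mulr_gt0.
have ec : e <> c by move=> ec; apply: nEc; rewrite -ec.
have ex : e <> x by move=> ex; apply: nEx; rewrite -ex.
have br_ec : br e c != 0 by rewrite br_eq0; apply/eqP.
have w0 : wc c e - wc c x != 0.
  by rewrite subr_eq0; apply/eqP => /(wc_inj ec xc).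
have := BE e Ee; rewrite (br_wc ec xc).
have -> : br e c / (wsign c * br c x * br e c * (wc c e - wc c x)) =
          (wsign c * br c x * (wc c e - wc c x))^-1.
  by field; rewrite br_ec w0 wsign_neq0 -normr_gt0 k0.
rewrite normfV !normrM; have -> : `|wsign c| = 1.
  by case: c {nEc xc BE k0 ec br_ec w0} => [?|]; rewrite /= ?normrN normr1.
rewrite mul1r => le_B; rewrite invfM mulrC.
have w1 : 0 < `|wc c e - wc c x| by rewrite normr_gt0.
rewrite ler_pdivrMr // mulrC; move: le_B; rewrite -[X in _ <= X]invrK lef_pV2 //.
  by rewrite posrE mulr_gt0.
by rewrite posrE invr_gt0.
Qed.

Lemma wc_bounded E c : ext_compact E -> ~ E c ->
  exists2 B : R, 0 < B & forall e, E e -> `|wc c e| <= B.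
Proof.
move=> cE nEc.
(* Up to sign, the numerator of [wc c] is the form vanishing at infinity when [c] is finite, and the
   form vanishing at 0 when [c] is infinite. *)
have [B B0 BE] := br_ratio_bounded (if c is Some _ then None else Some 0) cE nEc.
exists B => // e Ee; have := BE e Ee; case: c e nEc Ee {BE} => [y|] [x|] //=.
- by rewrite mul1r !normfV distrC.
- by rewrite mul0r.
- by rewrite subr0 divr1.
Qed.

(** * Gaps read in an affine coordinate *)

Lemma same_gapC E a b : same_gap E a b -> same_gap E b a.
Proof.
move=> [nEa [nEb H]]; split=> //; split=> //; case: H => H; [left|right] => z Hz; apply: H.
  by case: a b z Hz {nEa nEb} => [a|] [b|] [z|] //=; rewrite 1?minC 1?maxC //; case; auto.
by case: a b z Hz {nEa nEb} => [a|] [b|] [z|] //=; rewrite 1?minC 1?maxC.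
Qed.

Lemma same_gap_refl E a : ~ E a -> same_gap E a a.
Proof.
move=> nEa; split=> //; split=> //; left=> z Hz; suff -> : z = a by [].
case: a z Hz {nEa} => [a|] [z|] //=; last by case.
by rewrite minxx maxxx => /le_anti ->.
Qed.

Lemma lef_V2 (u v : R) : u != 0 -> v != 0 ->
  (u^-1 <= v^-1) = if 0 < u then (0 < v) && (v <= u) else (0 < v) || (v <= u).
Proof.
move=> u0 v0; case: (ltgtP 0 u) u0 => // [u1|u1] _; case: (ltgtP 0 v) v0 => // [v1|v1] _ /=.
- by rewrite lef_pV2 ?posrE.
- by apply/negbTE; rewrite -ltNge (@lt_trans _ _ 0) ?invr_lt0 ?invr_gt0.
- by rewrite ltW // (@lt_trans _ _ 0) ?invr_lt0 ?invr_gt0.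
- by rewrite lef_nV2 ?negrE.
Qed.

Lemma arc_base b x : x <> b -> exists o : bool, forall z, z <> b ->
  (arc1 b x z <-> if o then wc b x <= wc b z else wc b z <= wc b x) /\
  (arc2 b x z <-> if o then wc b z <= wc b x else wc b x <= wc b z).
Proof.
case: b x => [t|] [u|] //= xb.
- exists (u < t) => -[v|] zb; last first.
    move/Some_neq: xb; rewrite subr_eq0.
    case: (ltgtP t u) => // ut _; rewrite ?invr_le0 ?invr_ge0 subr_le0 ?subr_ge0 ?(ltW ut);
      rewrite ?leNgt ut; split; split=> //; by case.
  have tu := Some_neq xb; have tv := Some_neq zb.
  rewrite !lef_V2 //; move: tu tv; rewrite !subr_eq0.
  case: (ltgtP t u) => // tu _; case: (ltgtP t v) => // tv _; rewrite !subr_gt0;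
    rewrite ?tu ?tv ?(lt_gtF tu) ?(lt_gtF tv) /=;
    clear xb zb; split; split; rewrite ?ge_min ?le_max; lra.
- exists false => -[v|] zb; last by rewrite /= lexx; split; split=> //; left.
  rewrite /= invr_le0 invr_ge0 subr_le0 subr_ge0; by [].
- exists true => -[v|] zb //.
Qed.

Lemma same_gap_side E b x : same_gap E b x -> x <> b ->
  (forall e, E e -> wc b e < wc b x) \/ (forall e, E e -> wc b x < wc b e).
Proof.
move=> [nEb [nEx H]] xb; have [o oE] := arc_base xb.
have eb e : E e -> e <> b by move=> Ee eb; apply: nEb; rewrite -eb.
have side (A : option R -> Prop) : (forall z, A z -> ~ E z) ->
  ((forall z, z <> b -> (A z <-> wc b x <= wc b z)) -> forall e, E e -> wc b e < wc b x) /\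
  ((forall z, z <> b -> (A z <-> wc b z <= wc b x)) -> forall e, E e -> wc b x < wc b e).
  move=> AE; split=> AP e Ee; rewrite ltNge; apply/negP => le.
    by apply: (AE e) => //; apply/AP => //; apply: eb.
  by apply: (AE e) => //; apply/AP => //; apply: eb.
case: H => /side [H1 H2]; case: o oE => oE.
- by left; apply: H1 => z /oE [].
- by right; apply: H2 => z /oE [].
- by right; apply: H2 => z /oE [].
- by left; apply: H1 => z /oE [].
Qed.

Lemma side_same_gap E b x : ~ E b -> ~ E x -> x <> b ->
  (forall e, E e -> wc b e < wc b x) \/ (forall e, E e -> wc b x < wc b e) ->
  same_gap E b x.
Proof.
move=> nEb nEx xb H; split=> //; split=> //; have [o oE] := arc_base xb.
have eb e : E e -> e <> b by move=> Ee eb; apply: nEb; rewrite -eb.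
case: H => H; case: o oE => oE; [left|right|right|left] => z Az Ez; have zb := eb z Ez;
  have := H z Ez; move: Az; case: (oE z zb) => o1 o2 /[dup]; by [move/o1; case: ltgtP|move/o2; case: ltgtP].
Qed.

(** The arc from [x] to [y] that misses the pole [b] is the one mapped to the segment between their
    coordinates. *)
Lemma arc_between b x y : x <> b -> y <> b -> wc b x < wc b y ->
  let between z := z <> b /\ wc b x <= wc b z <= wc b y in
  (forall z, arc1 x y z -> between z) \/ (forall z, arc2 x y z -> between z).
Proof.
have SomeE (u v : R) : u != v -> Some u <> Some v by move=> n [e]; rewrite e eqxx in n.
case: b x y => [t|] [u|] [v|] //= ub vb; rewrite ?ltxx //.
- have tu := Some_neq ub; have tv := Some_neq vb; rewrite ltNge lef_V2 //.
  move: tu tv; rewrite !subr_eq0 => tu tv uv.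
  move: uv; rewrite !subr_gt0.
  have le_V (r z : R) : t != r -> t != z -> ((t - r)^-1 <= (t - z)^-1) =
      if r < t then (z < t) && (r <= z) else (z < t) || (r <= z).
    by move=> tr tz; rewrite lef_V2 ?subr_eq0 // !subr_gt0 lerD2l lerN2.
  have le_V0 (r : R) : ((t - r)^-1 <= 0) = (t <= r) by rewrite invr_le0 subr_le0.
  have ge_V0 (r : R) : (0 <= (t - r)^-1) = (r <= t) by rewrite invr_ge0 subr_ge0.
  have neq (r : R) : (r < t) || (t < r) -> Some r <> Some t /\ t != r.
    by rewrite orbC -neq_lt => n; split=> //; apply: SomeE; rewrite eq_sym.
  clear ub vb SomeE.
  (* If [u] and [v] are on one side of [t], the arc is the interval between them; if [v < t < u], it
     runs through infinity. The case [u < t < v] contradicts the order of the coordinates. *)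
  case: (ltgtP t u) (tu) => // ut _; case: (ltgtP t v) (tv) => // vt _ /= uv.
  - have {uv} uv : u < v by move: uv; rewrite -?ltNge; clear -ut vt; lra.
    left=> -[r|]; last by case.
    rewrite /= minElt maxElt uv => ur; have tr' : (r < t) || (t < r) by clear -ut vt uv ur; lra.
    have [rt tr] := neq r tr'; move/orP: tr' => tr'.
    split=> //=; rewrite !le_V //; rewrite ?(lt_gtF ut) ?(lt_gtF vt) ?ut ?vt.
    by case: tr' => tr'; rewrite ?tr' ?(lt_gtF tr') /=; clear -ut vt uv ur tr'; lra.
  - right=> -[r|] /=; last by rewrite le_V0 ge_V0 !ltW.
    have {uv} uv : v < u by apply: lt_trans ut.
    rewrite minC maxC minElt maxElt uv => ur; have tr' : (r < t) || (t < r) by clear -ut vt uv ur; lra.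
    have [rt tr] := neq r tr'; move/orP: tr' => tr'.
    split=> //=; rewrite !le_V //; rewrite ?(lt_gtF ut) ?(lt_gtF vt) ?ut ?vt.
    by case: tr' => tr'; rewrite ?tr' ?(lt_gtF tr') /=; clear -ut vt uv ur tr'; lra.
  - have {uv} uv : u < v by move: uv; rewrite -?ltNge; clear -ut vt; lra.
    left=> -[r|]; last by case.
    rewrite /= minElt maxElt uv => ur; have tr' : (r < t) || (t < r) by clear -ut vt uv ur; lra.
    have [rt tr] := neq r tr'; move/orP: tr' => tr'.
    split=> //=; rewrite !le_V //; rewrite ?(lt_gtF ut) ?(lt_gtF vt) ?ut ?vt.
    by case: tr' => tr'; rewrite ?tr' ?(lt_gtF tr') /=; clear -ut vt uv ur tr'; lra.
- rewrite invr_lt0 subr_lt0 => tu; left=> -[r|] /=; last by rewrite lexx invr_le0 subr_le0 ltW.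
  move=> ur; split; first by apply: SomeE; rewrite gt_eqF // (lt_le_trans tu).
  have tr := lt_le_trans tu ur.
  by rewrite invr_le0 subr_le0 (ltW tr) lef_nV2 ?negrE ?subr_lt0 // lerD2l lerN2 ur.
- rewrite invr_gt0 subr_gt0 => vt; right=> -[r|] /=; last by rewrite lexx invr_ge0 subr_ge0 ltW.
  move=> rv; split; first by apply: SomeE; rewrite lt_eqF // (le_lt_trans rv).
  have rt := le_lt_trans rv vt.
  by rewrite invr_ge0 subr_ge0 (ltW rt) lef_pV2 ?posrE ?subr_gt0 // lerD2l lerN2 rv.
- move=> uv; left=> -[r|]; last by case.
  by rewrite /= minElt maxElt uv.
Qed.

Lemma between_same_gap E b x y : ~ E x -> ~ E y -> x <> b -> y <> b ->
  (forall e, E e -> ~ wc b x < wc b e < wc b y) -> wc b x < wc b y ->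
  same_gap E x y.
Proof.
move=> nEx nEy xb yb noE xy; split=> //; split=> //.
have nE z : z <> b /\ wc b x <= wc b z <= wc b y -> ~ E z.
  move=> [zb /andP[xz zy]] Ez; apply: (noE z Ez); rewrite !lt_neqAle xz zy !andbT.
  apply/andP; split; apply/eqP => /wc_inj e; [apply: nEx; rewrite e|apply: nEy; rewrite -e] => //.
by case: (arc_between xb yb xy) => H; [left|right] => z /H /nE.
Qed.

(** * Limits of rational functions along the real line *)

Lemma normC_real (x : R) : `|x%:C| = `|x|%:C.
Proof. by rewrite normc_def /= expr0n /= addr0 sqrtr_sqr. Qed.

(** Factor [p - p(x0)] as [X - x0] times [g] and bound [g] on the disk of radius [|x0| + 1]; the
    minimum with 1 keeps [x] in that disk. *)
Lemma poly_continuous p (x0 : R) (eps : R[i]) : 0 < eps ->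
  exists2 d : R, 0 < d & forall x : R, `|x - x0| < d -> `|p.[x%:C] - p.[x0%:C]| < eps.
Proof.
move=> eps0; have /factor_theorem [g gE] : root (p - p.[x0%:C]%:P) x0%:C.
  by rewrite /root !hornerE subrr.
have [K KE] := poly_disk_bound g (`|x0| + 1)%:C.
have K0 : 0 <= K by apply: le_trans (KE 0 _); rewrite ?normr_ge0 // normr0 ler0c addr_ge0.
have e0 : 0 < eps / (K + 1) by rewrite divr_gt0 // ltr_wpDl.
have eR := RRe_real (gtr0_real e0).
exists (Num.min 1 (complex.Re (eps / (K + 1)))) => [|x].
  by rewrite lt_min ltr01 -ltcR eR.
rewrite lt_min -[X in _ && X]ltcR eR => /andP[x1 xe].
have -> : p.[x%:C] - p.[x0%:C] = (p - p.[x0%:C]%:P).[x%:C] by rewrite !hornerE.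
rewrite gE !hornerE normrM -rmorphB normC_real.
have gx : `|g.[x%:C]| <= K.
  apply: KE; rewrite normC_real lecR -[x](subrK x0) addrC.
  by apply: le_trans (ler_normD _ _) _; rewrite lerD2l ltW.
apply: le_lt_trans (_ : (K + 1) * `|x - x0|%:C < _).
  by rewrite ler_wpM2r ?lecR // (le_trans gx) // lerDl ler01.
by rewrite mulrC -ltr_pdivlMr // ltr_wpDl.
Qed.

Lemma lim_quotient p q (x0 : R) : q.[x0%:C] != 0 ->
  has_lim (fun x => p.[x%:C] / q.[x%:C]) (Some x0) (p.[x0%:C] / q.[x0%:C]).
Proof.
move=> q0 eps eps0; set m := `|q.[x0%:C]|; have m0 : 0 < m by rewrite normr_gt0.
(* The difference of the quotients is [D(x) / (q(x0) q(x))], where [D(x0) = 0] and [|q(x)| > m / 2]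
   near [x0]; hence the tolerance [eps * (m * (m / 2))] for [D]. *)
pose D := q.[x0%:C] *: p - p.[x0%:C] *: q.
have epsC : 0 < eps%:C by rewrite ltcR.
have m2 : 0 < m / 2 by rewrite divr_gt0.
have em : 0 < eps%:C * (m * (m / 2)) by rewrite mulr_gt0 // mulr_gt0.
have [d1 d10 d1E] := poly_continuous D x0 em.
have [d2 d20 d2E] := poly_continuous q x0 m2.
exists (Num.min d1 d2); split; first by rewrite lt_min d10.
move=> x _; rewrite lt_min => /andP[/d1E + /d2E qx].
have qm : m / 2 < `|q.[x%:C]|.
  have : m <= `|q.[x%:C] - q.[x0%:C]| + `|q.[x%:C]|.
    by rewrite distrC; apply: le_trans (ler_normD _ _); rewrite subrK.
  rewrite -lerBlDl => /(lt_le_trans _); apply.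
  by rewrite ltrBrDr -ltrBrDl (_ : m - m / 2 = m / 2) //; field.
have qx0 : q.[x%:C] != 0 by rewrite -normr_gt0 (lt_trans _ qm) ?divr_gt0.
have -> : D.[x0%:C] = 0 by rewrite /D !hornerE; ring.
rewrite subr0 /D hornerD hornerN !hornerZ => Dx.
have -> : p.[x%:C] / q.[x%:C] - p.[x0%:C] / q.[x0%:C] =
  (q.[x0%:C] * p.[x%:C] - p.[x0%:C] * q.[x%:C]) / (q.[x0%:C] * q.[x%:C]).
  by field; rewrite q0 qx0.
rewrite normrM normfV normrM -/m ltr_pdivrMr ?mulr_gt0 ?normr_gt0 //.
by apply: lt_trans Dx _; rewrite (ltr_pM2l epsC) (ltr_pM2l m0).
Qed.

(** The reciprocal polynomial [X^m p(1/X)], which carries limits at infinity to limits at 0. *)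
Definition revp (m : nat) p : {poly R[i]} := \poly_(i < m.+1) p`_(m - i).

Lemma horner_revp m p (x : R[i]) : (size p <= m.+1)%N -> x != 0 ->
  p.[x] = x ^+ m * (revp m p).[x^-1].
Proof.
move=> sp x0; rewrite (horner_coef_wide _ sp) (horner_coef_wide _ (size_poly _ _)).
rewrite mulr_sumr (reindex_inj rev_ord_inj) /=; apply: eq_bigr => i _.
rewrite subSS coef_poly ltn_ord mulrCA; congr (_ * _).
by rewrite exprVn expfB_cond // (negbTE x0) add0n -ltnS.
Qed.

Lemma lim_quotient_infty m p q : (size p <= m.+1)%N -> (size q <= m.+1)%N ->
  q`_m != 0 -> has_lim (fun x => p.[x%:C] / q.[x%:C]) None (p`_m / q`_m).
Proof.
move=> sp sq qm eps eps0.
have rev0 P : (revp m P).[0%:C] = P`_m by rewrite horner_coef0 coef_poly subn0.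
have q0 : (revp m q).[0%:C] != 0 by rewrite rev0.
have [d [d0 dE]] := lim_quotient (revp m p) q0 eps0.
exists d^-1 => x dx; have x0 : x != 0 by rewrite -normr_gt0 (lt_trans _ dx) ?invr_gt0.
have xC : x%:C != 0 by rewrite fmorph_eq0.
rewrite -!rev0 (horner_revp sp xC) (horner_revp sq xC) -fmorphV.
rewrite invfM mulrACA mulfV ?expf_neq0 // mul1r; apply: dE; first by rewrite invr_eq0.
by rewrite subr0 normfV -[d]invrK ltf_pV2 ?posrE ?invr_gt0 ?normr_gt0.
Qed.

Lemma lim_form Ds p q P z : is_ratfun p q -> p * linprod Ds = P * q ->
  (size P <= (size Ds).+1)%N -> z \notin Ds ->
  has_lim (fun x => rval p q (Some x)) z
    (hval (size Ds) P z / hval (size Ds) (linprod Ds) z).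
Proof.
move=> pq e sP zDs; rewrite -(rval_form pq e sP zDs).
have := form_size pq e sP zDs; have := form_denom_neq0 pq e zDs.
have [q0 _] := pq; case: z zDs => [x|] zDs /= qx spq; first exact: lim_quotient.
rewrite [X in has_lim _ _ X](rval_hval None (spq _)) //.
by apply: lim_quotient_infty; rewrite // ?(leq_trans (spq _)) ?leqSpred.
Qed.

Lemma has_lim_unique (f : R -> R[i]) z l1 l2 : has_lim f z l1 -> has_lim f z l2 -> l1 = l2.
Proof.
move=> L1 L2; apply/eqP; rewrite -subr_eq0 -normr_eq0; apply/negPn/negP => n0.
have e0 : 0 < `|l1 - l2| / 2 by rewrite divr_gt0 // lt0r n0 normr_ge0.
have eR := RRe_real (gtr0_real e0).
have rR : 0 < complex.Re (`|l1 - l2| / 2) by rewrite -ltcR eR.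
suff [x] : exists x, `|f x - l1| < (complex.Re (`|l1 - l2| / 2))%:C /\
                     `|f x - l2| < (complex.Re (`|l1 - l2| / 2))%:C.
  rewrite eR => -[x1 x2]; have := ltrD x1 x2; rewrite -splitr => lt.
  suff : `|l1 - l2| < `|l1 - l2| by rewrite ltxx.
  apply: le_lt_trans lt; rewrite [`|f x - l1|]distrC.
  by apply: le_trans (ler_normD _ _); rewrite addrA subrK.
move: L1 L2 => /(_ _ rR) + /(_ _ rR); case: z => [a|].
  move=> [d1 [d10 H1]] [d2 [d20 H2]]; exists (a + Num.min d1 d2 / 2).
  have d0 : 0 < Num.min d1 d2 by rewrite lt_min d10.
  have ne : a + Num.min d1 d2 / 2 != a by rewrite -subr_eq0 addrC addKr gt_eqF ?divr_gt0.
  have lt : `|a + Num.min d1 d2 / 2 - a| < Num.min d1 d2.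
    by rewrite addrC addKr gtr0_norm ?divr_gt0 // ltr_pdivrMr // ltr_pMr // ltr1n.
  by move: lt; rewrite lt_min => /andP[lt1 lt2]; split; [apply: H1|apply: H2].
move=> [M1 H1] [M2 H2]; exists (`|M1| + `|M2| + 1).
have := ler_norm M1; have := ler_norm M2; have := normr_ge0 M1; have := normr_ge0 M2 => *.
by split; [apply: H1|apply: H2]; rewrite ger0_norm; lra.
Qed.

(** For a limit at infinity the functions may differ at 0, where [rker None] vanishes. *)
Lemma has_lim_ext (f g : R -> R[i]) z l :
  (forall x, Some x <> z -> x != 0 \/ z <> None -> f x = g x) -> has_lim f z l -> has_lim g z l.
Proof.
move=> fg L eps eps0; move: (L eps eps0); case: z fg {L} => [a|] fg.
  case=> d [d0 H]; exists d; split=> // x xa xd; rewrite -fg; first exact: H.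
    by case=> e; rewrite e eqxx in xa.
  by right.
case=> M H; exists `|M| => x Mx; rewrite -fg; first by apply: H; apply: le_lt_trans Mx; exact: ler_norm.
  by [].
by left; rewrite -normr_gt0 (le_lt_trans _ Mx).
Qed.

(** * Competitors that beat a constant *)

Lemma in_L_sub Ds Ds' p q : (forall z, (count_mem z Ds' <= count_mem z Ds)%N) ->
  in_L Ds' p q -> in_L Ds p q.
Proof.
move=> sub inL z; apply: leq_trans (inL z) _.
by case: z {inL} => [x|] /=; [case: ifP => // _|]; apply: sub.
Qed.

Definition has_sign (t : R) := t = 1 \/ t = -1.

(** When [xs] is not in [Ds], such a competitor excludes a constant extremal function, since an
    admissible constant has modulus at most 1. *)
Definition beaten E Ds xs := exists p q l,
  [/\ admissible E Ds p q, functional_lim Ds xs p q l & 1 < complex.Re l].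

(** The competitor is [1 + g / B], which lies in [0, 1] on E and exceeds 1 at [xs]. The divisor
    [Ds'] carries the poles of [g], and [T] is the numerator of [g] over [linprod Ds']. *)
Lemma perturb E Ds Ds' xs T (g : option R -> R) (B : R) :
  (forall z, z \in Ds' -> ~ E z) -> xs \notin Ds ->
  (forall z, (count_mem z Ds' <= count_mem z Ds)%N) ->
  (size T <= (size Ds').+1)%N ->
  (forall z, z \notin Ds' ->
     hval (size Ds') T z = (g z)%:C * hval (size Ds') (linprod Ds') z) ->
  0 < B -> (forall e, E e -> - B <= g e <= 0) -> 0 < g xs -> beaten E Ds xs.
Proof.
move=> DsE xsD sub sT TE B0 gE gx.
have xsD' : xs \notin Ds'.
  have := sub xs; have /count_memPn -> := xsD; rewrite leqn0 => /eqP cnt.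
  by apply/count_memPn.
have k0 : 0 < B^-1 by rewrite invr_gt0.
pose P := linprod Ds' + (B^-1)%:C *: T.
have sP : (size P <= (size Ds').+1)%N.
  rewrite (leq_trans (size_polyD _ _)) // geq_max size_linprod.
  by rewrite (leq_trans (size_scale_leq _ _)).
have PE z : z \notin Ds' ->
    hval (size Ds') P z / hval (size Ds') (linprod Ds') z = (1 + B^-1 * g z)%:C.
  move=> zD; rewrite hvalD hvalZ TE // rmorphD rmorphM rmorph1.
  by rewrite -[X in X + _]mul1r mulrA -mulrDl mulfK ?hval_linprod_neq0.
have [p [q [pq inL e]]] := in_L_make sP.
have EN z : E z -> z \notin Ds' by move=> Ez; apply/negP => /DsE.
exists p, q, (1 + B^-1 * g xs)%:C; split.
- split=> //; split=> [|z Ez]; first exact: in_L_sub inL.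
  rewrite (rval_form pq e sP (EN z Ez)) PE ?EN // normC_real lecR.
  have /andP[g1 g2] := gE z Ez.
  have : -1 <= B^-1 * g z by rewrite ler_pdivlMl // mulrN1.
  have : B^-1 * g z <= 0 by rewrite pmulr_rle0.
  by rewrite ler_norml; lra.
- rewrite -PE //; apply: has_lim_ext (lim_form pq e sP xsD') => x _ _.
  by rewrite /divv (count_memPn xsD) expr0 divr1.
- by rewrite /= ltrDl mulr_gt0.
Qed.

Definition wshift c x : {poly R[i]} := wpol c - (wc c x)%:C *: lin c.

Lemma size_wshift c x : (size (wshift c x) <= 2)%N.
Proof.
rewrite (leq_trans (size_polyD _ _)) // geq_max size_wpol size_polyN.
by rewrite (leq_trans (size_scale_leq _ _)) ?size_lin.
Qed.

Lemma hval1_wshift c x z : z <> c ->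
  hval 1 (wshift c x) z = ((wc c z - wc c x) * br z c)%:C.
Proof.
move=> zc; rewrite hvalD hvalN hvalZ hval1_lin hval1_wpol //.
by rewrite -!(rmorphD, rmorphM, rmorphB) /= mulrBl.
Qed.

(** The sign [t] orients the coordinate so that [xs] lies above E. By the separation [d], the
    function [t * (wc c z - wc c xs) + d] is nonpositive on E, and it equals [d] at [xs]. *)
Lemma beaten_simple E Ds xs c (t : R) : ext_compact E -> c \in Ds -> ~ E c ->
  ~ E xs -> xs \notin Ds -> has_sign t ->
  (forall e, E e -> t * wc c e < t * wc c xs) -> beaten E Ds xs.
Proof.
move=> cE cD nEc nEx xD tsgn side.
have xc : xs <> c by move=> xc; move: xD; rewrite xc cD.
have [d d0 dE] := wc_sep cE nEc nEx xc; have [B B0 BE] := wc_bounded cE nEc.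
pose T := t%:C *: wshift c xs + d%:C *: lin c.
have sT : (size T <= 2)%N.
  rewrite (leq_trans (size_polyD _ _)) // geq_max !(leq_trans (size_scale_leq _ _)) ?size_lin ?size_wshift //.
apply: (@perturb E Ds [:: c] xs T (fun z => t * (wc c z - wc c xs) + d) (B + `|wc c xs|)) => //.
- by move=> z; rewrite inE => /eqP ->.
- move=> z /=; rewrite addn0; case: eqP => // <-.
  by rewrite -has_count has_pred1.
- move=> z; rewrite inE => /eqP zc; rewrite hval_linprod big_seq1 /=.
  rewrite /T hvalD !hvalZ hval1_lin hval1_wshift //.
  by rewrite -!(rmorphD, rmorphM, rmorphB) /=; congr _%:C; ring.
- by rewrite ltr_wpDr.
- move=> e Ee; have := BE e Ee; have := dE e Ee; have := side e Ee.
  have := ler_norm (wc c xs); have := lerNnormlW (lexx `|wc c xs|).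
  rewrite (ler_norml (wc c e)); case: tsgn => ->; case: (ltrgt0P (wc c e - wc c xs)); lra.
- by rewrite subrr mulr0 add0r.
Qed.

(** The quadratic form which is the numerator of [d ^+ 2 - (wc c z - wc c xs) ^+ 2] over the square
    of [lin c]. *)
Definition parabola c xs (d : R) : {poly R[i]} :=
  (d ^+ 2)%:C *: (lin c * lin c) -
  wshift c xs * wshift c xs.

Lemma size_parabola c xs d : (size (parabola c xs d) <= 3)%N.
Proof.
rewrite (leq_trans (size_polyD _ _)) // geq_max size_polyN.
by rewrite (leq_trans (size_scale_leq _ _)) !(@size_mul_leqD 1 1) ?size_lin ?size_wshift.
Qed.

Lemma hval_parabola c xs d z : z <> c ->
  hval 2 (parabola c xs d) z = ((d ^+ 2 - (wc c z - wc c xs) ^+ 2) * br z c ^+ 2)%:C.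
Proof.
move=> zc; rewrite /parabola hvalD hvalZ hvalN !(@hvalM 1 1) ?size_lin ?size_wshift //.
rewrite hval1_lin hval1_wshift //.
by rewrite -!(rmorphD, rmorphM, rmorphB) /=; congr _%:C; ring.
Qed.

Lemma sqr_ge_norm (x y : R) : `|x| <= y -> x ^+ 2 <= y ^+ 2.
Proof. by move=> xy; rewrite -(real_normK (num_real x)) ler_sqr ?nnegrE ?normr_ge0 // (le_trans _ xy). Qed.

Lemma sqr_le_norm (x y : R) : 0 <= y -> y <= `|x| -> y ^+ 2 <= x ^+ 2.
Proof. by move=> y0 yx; rewrite -(real_normK (num_real x)) ler_sqr ?nnegrE ?normr_ge0. Qed.

(** A double pole leaves room for a parabola peaked at [xs], wherever [c] lies relative to [xs]. *)
Lemma beaten_double E Ds xs c : ext_compact E -> (1 < count_mem c Ds)%N -> ~ E c ->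
  ~ E xs -> xs \notin Ds -> beaten E Ds xs.
Proof.
move=> cE cD nEc nEx xD.
have cDs : c \in Ds by rewrite -has_pred1 has_count (ltn_trans _ cD).
have xc : xs <> c by move=> xc; move: xD; rewrite xc cDs.
have [d d0 dE] := wc_sep cE nEc nEx xc; have [B B0 BE] := wc_bounded cE nEc.
apply: (@perturb E Ds [:: c; c] xs (parabola c xs d)
  (fun z => d ^+ 2 - (wc c z - wc c xs) ^+ 2) ((B + `|wc c xs|) ^+ 2)) => //.
- by move=> z; rewrite !inE => /orP[] /eqP ->.
- by move=> z /=; rewrite addn0; case: eqP => // <-.
- exact: size_parabola.
- move=> z; rewrite !inE orbb => /eqP zc; rewrite hval_linprod unlock /= mulr1.
  by rewrite hval_parabola // -rmorphM.
- by rewrite exprn_gt0 // ltr_wpDr.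
- move=> e Ee; apply/andP; split.
    rewrite lerNl opprB (le_trans (y := (wc c e - wc c xs) ^+ 2)) ?lerBlDr ?lerDl ?sqr_ge0 //.
    by apply: sqr_ge_norm; rewrite (le_trans (ler_normB _ _)) // lerD2r BE.
  by rewrite subr_le0 sqr_le_norm ?(ltW d0) ?dE.
- by rewrite subrr expr0n subr0 exprn_gt0.
Qed.

(** With pole [c1], all of E lies on one side of [c2]. If [xs] lies on that side too, dividing the
    parabola by a linear factor positive there keeps its signs and turns the double pole at [c1]
    into simple poles at [c1] and [c2]. *)
Lemma beaten_pair E Ds xs c1 c2 : ext_compact E ->
  (forall z, (count_mem z [:: c1; c2] <= count_mem z Ds)%N) ->
  same_gap E c1 c2 -> ~ E xs -> xs \notin Ds -> beaten E Ds xs.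
Proof.
move=> cE sub sg nEx xD; have [nE1 [nE2 _]] := sg.
have cD c : c \in [:: c1; c2] -> c \in Ds.
  by rewrite -!has_pred1 !has_count => /leq_trans; apply.
have c1D : c1 \in Ds by apply: cD; rewrite !inE eqxx.
have c2D : c2 \in Ds by apply: cD; rewrite !inE eqxx orbT.
have xc1 : xs <> c1 by move=> xc; move: xD; rewrite xc c1D.
have xc2 : xs <> c2 by move=> xc; move: xD; rewrite xc c2D.
have [c12|/eqP c12] := eqVneq c2 c1.
  by apply: (@beaten_double E Ds xs c1) => //; have := sub c1; rewrite /= c12 eqxx.
have [t [tsgn side]] : exists t, has_sign t /\ forall e, E e -> t * wc c1 e < t * wc c1 c2.
  case: (same_gap_side sg c12) => H; [exists 1|exists (-1)]; split; rewrite /has_sign; auto.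
    by move=> e Ee; rewrite !mul1r H.
  by move=> e Ee; rewrite !mulN1r ltrN2 H.
have t0 : t != 0 by case: tsgn => ->; rewrite ?oppr_eq0 oner_eq0.
have wx2 : wc c1 xs != wc c1 c2 by apply/eqP => /(wc_inj xc1 c12).
(* If [xs] lies beyond [c2] as seen from E, it also lies beyond E, and a simple pole at [c1]
   suffices. *)
have [lt|] := ltP (t * wc c1 c2) (t * wc c1 xs).
  by apply: (beaten_simple cE c1D nE1 nEx xD tsgn) => e /side /lt_trans; apply.
rewrite le_eqVlt (inj_eq (mulfI t0)) (negbTE wx2) /= => lt.
have [d d0 dE] := wc_sep cE nE1 nEx xc1; have [B B0 BE] := wc_bounded cE nE1.
have [d2 d20 d2E] := wc_sep cE nE1 nE2 c12.
(* By [br_wc], [t / (wc c1 c2 - wc c1 z)] equals [k * br z c1 / br z c2]. *)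
pose k := - t * (wsign c1 * br c1 c2).
have tt : t * t = 1 by case: tsgn => ->; ring.
have side_gt0 z : t * wc c1 z < t * wc c1 c2 -> 0 < t / (wc c1 c2 - wc c1 z).
  move=> h; have -> : t / (wc c1 c2 - wc c1 z) = (t * (wc c1 c2 - wc c1 z))^-1.
    by rewrite invfM; congr (_ / _); apply: (mulfI t0); rewrite tt mulfV.
  by rewrite invr_gt0 mulrBr subr_gt0.
apply: (@perturb E Ds [:: c1; c2] xs (k%:C *: parabola c1 xs d)
  (fun z => (d ^+ 2 - (wc c1 z - wc c1 xs) ^+ 2) * (t / (wc c1 c2 - wc c1 z)))
  ((B + `|wc c1 xs|) ^+ 2 / d2)) => //.
- by move=> z; rewrite !inE => /orP[] /eqP ->.
- by rewrite (leq_trans (size_scale_leq _ _)) ?size_parabola.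
- move=> z; rewrite !inE negb_or => /andP[/eqP z1 /eqP z2].
  rewrite hval_linprod unlock /= mulr1 hvalZ hval_parabola // -!rmorphM; congr _%:C.
  have w2 : wc c1 c2 - wc c1 z != 0.
    by rewrite subr_eq0 eq_sym; apply/eqP => /(wc_inj z1 c12).
  by rewrite (br_wc z1 c12) /k; field.
- by rewrite divr_gt0 // exprn_gt0 // ltr_wpDr.
- move=> e Ee; have h0 := side_gt0 e (side e Ee); apply/andP; split; last first.
    by rewrite pmulr_lle0 // subr_le0 sqr_le_norm ?(ltW d0) ?dE.
  rewrite lerNl -mulNr opprB ler_pM ?(ltW h0) //.
  + by rewrite subr_ge0 sqr_le_norm ?(ltW d0) ?dE.
  + rewrite (le_trans (y := (wc c1 e - wc c1 xs) ^+ 2)) ?lerBlDr ?lerDl ?sqr_ge0 //.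
    by apply: sqr_ge_norm; rewrite (le_trans (ler_normB _ _)) // lerD2r BE.
  + rewrite -[X in X <= _]gtr0_norm // normrM normfV.
    have -> : `|t| = 1 by case: tsgn => ->; rewrite ?normrN normr1.
    have pos : 0 < `|wc c1 c2 - wc c1 e| by rewrite (lt_le_trans d20) // distrC d2E.
    by rewrite mul1r lef_pV2 ?posrE // distrC d2E.
- rewrite subrr expr0n subr0 mulr_gt0 ?exprn_gt0 //; exact: side_gt0.
Qed.

Lemma has_lim_const (k : R[i]) z : has_lim (fun=> k) z k.
Proof.
move=> eps eps0; have k0 : `|k - k| < eps%:C by rewrite subrr normr0 ltcR.
by case: z => [a|]; [exists 1; split|exists 0].
Qed.

Lemma lim_const_div_rker (k : R[i]) c (d : nat) :
  (0 < d)%N -> has_lim (fun x => k / rker c x ^+ d) c 0.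
Proof.
move=> d0; case: c => [a|].
  have one (x : R) : (1 : {poly R[i]}).[x%:C] = 1 by rewrite hornerE.
  have := @lim_quotient (k *: (a%:C%:P - 'X) ^+ d) 1 a.
  rewrite one oner_eq0 !hornerE subrr expr0n eqn0Ngt d0 mulr0 divr1 => /(_ isT).
  apply: has_lim_ext => x _ _; rewrite one !hornerE divr1.
  by rewrite exprVn invrK.
have := @lim_quotient_infty d k%:P 'X^d; rewrite size_polyXn coefXn eqxx oner_eq0.
rewrite coefC eqn0Ngt d0 mul0r (leq_trans (size_polyC_leq1 _)) // ltnSn => /(_ isT isT isT).
by apply: has_lim_ext => x _ _; rewrite hornerC hornerXn.
Qed.

(** Take the power [d] of [wc xs / B]. At finite points [wc xs] agrees with [rker xs], so the
    functional takes the value [B^-1 ^+ d]. *)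
Lemma pole_competitor E Ds xs : ext_compact E -> ~ E xs ->
  exists p q l, [/\ admissible E Ds p q, functional_lim Ds xs p q l & 0 < complex.Re l].
Proof.
move=> cE nEx; have [B B0 BE] := wc_bounded cE nEx.
have k0 : 0 < B^-1 by rewrite invr_gt0.
set d := divv Ds xs; pose Ds' := nseq d xs; pose f c := (B^-1)%:C *: wpol c.
have sf c : (size (f c) <= 2)%N by rewrite (leq_trans (size_scale_leq _ _)) ?size_wpol.
pose P := \prod_(c <- Ds') f c.
have sP : (size P <= (size Ds').+1)%N by apply: size_prod_lin.
have inD z : z <> xs -> z \notin Ds'.
  by move=> zx; apply/negP; rewrite mem_nseq => /andP[_ /eqP].
have PE z : z <> xs -> hval (size Ds') P z / hval (size Ds') (linprod Ds') z =
    ((B^-1 * wc xs z) ^+ d)%:C.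
  move=> zx; rewrite hval_linprod hval_prod_lin // rmorph_prod -prodf_div.
  rewrite (eq_big_seq (fun=> (B^-1 * wc xs z)%:C)) => [|c].
    by rewrite big_const_seq count_predT size_nseq iter_mulr_1 rmorphXn.
  rewrite mem_nseq => /andP[_ /eqP ->]; rewrite hvalZ hval1_wpol // -rmorphM mulrA.
  by rewrite rmorphM mulfK // fmorph_eq0 br_eq0; apply/eqP.
have [p [q [pq inL e]]] := in_L_make sP.
have nE z : E z -> z <> xs by move=> Ez zx; apply: nEx; rewrite -zx.
exists p, q, ((B^-1) ^+ d)%:C; split; last by rewrite /= exprn_gt0.
- split=> //; split=> [|z Ez].
    apply: in_L_sub inL => z; rewrite count_nseq /=; case: eqP => [<-|_] //.
    by rewrite mul1n.
  have zx := nE z Ez; rewrite (rval_form pq e sP (inD z zx)) PE // normC_real lecR.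
  rewrite normrX exprn_ile1 // normrM normfV (gtr0_norm B0) mulrC ler_pdivrMr // mul1r.
  exact: BE.
- apply: has_lim_ext (has_lim_const _ _) => x xx x0.
  rewrite (rval_form pq e sP (inD _ xx)) PE //.
  have wE : (wc xs (Some x))%:C = rker xs x.
    by case: (xs) => [y|] //=; rewrite fmorphV rmorphB.
  have -> : ((B^-1 * wc xs (Some x)) ^+ d)%:C = (B^-1 ^+ d)%:C * rker xs x ^+ d.
    by rewrite -wE -rmorphXn -rmorphM -exprMn.
  rewrite mulfK // expf_neq0 // -wE fmorph_eq0.
  case: (xs) xx x0 => [y|] xx x0 /=; last by case: x0.
  by rewrite invr_eq0 subr_eq0; apply/eqP => e'; apply: xx; rewrite e'.
Qed.

(** Coprimality of [k *: q] and [q] makes [q] a nonzero constant, also when [k = 0]. *)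
Lemma ratfun_const (k : R[i]) q : is_ratfun (k *: q) q ->
  forall z, rval (k *: q) q z = k.
Proof.
move=> [q0 cpq]; have sq : size q = 1%N.
  apply/eqP; have := cpq; have [->|k0] := eqVneq k 0.
    by rewrite scale0r => /ratfun0_size ->.
  by rewrite (eqp_coprimepl _ (eqp_scale _ k0)) coprimepp.
move: (q0); rewrite (size1_polyC (eq_leq sq)) polyC_eq0 => qc.
case=> [x|] /=; first by rewrite hornerZ hornerC mulfK.
have [->|k0] := eqVneq k 0; first by rewrite scale0r size_poly0 lt0n size_poly_eq0 polyC_eq0 qc.
by rewrite size_scale // ltnn eqxx lead_coefZ mulfK // lead_coef_eq0 polyC_eq0.
Qed.

(** * A constant extremal function forces distinct gaps *)

Lemma const_gaps E Ds xs p q : ext_compact E -> ext_infinite E ->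
  (forall z, z \in Ds -> ~ E z) -> ~ E xs -> is_extremal E Ds xs p q ->
  (exists k : R[i], p = k *: q) ->
  forall i j, (i < (size Ds).+1)%N -> (j < (size Ds).+1)%N -> i <> j ->
    ~ same_gap E (nth None (xs :: Ds) i) (nth None (xs :: Ds) j).
Proof.
move=> cE iE DsE nEx [[pq [_ le1]] [lF [limF maxF]]] [k pE].
rewrite {p}pE in pq le1 limF.
have Fk := ratfun_const pq.
(* If [xs] were a pole point, the functional would vanish on constants, while [pole_competitor]
   gives a positive value. *)
have xD : xs \notin Ds.
  apply/negP => xD; have [p1 [q1 [l1 [adm1 lim1 l10]]]] := pole_competitor Ds cE nEx.
  have d0 : (0 < divv Ds xs)%N by rewrite -has_count has_pred1.
  have l0 : lF = 0.
    apply: has_lim_unique limF _; apply: has_lim_ext (lim_const_div_rker k xs d0) => x _ _.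
    by rewrite Fk.
  by have := maxF _ _ _ adm1 lim1; rewrite l0 leNgt l10.
have [e Ee] : exists e, E e.
  apply: NNPP => nE; apply: iE; exists [::] => z Ez; case: nE; by exists z.
have lk : lF = k.
  apply: has_lim_unique limF _; apply: has_lim_ext (has_lim_const k xs) => x _ _.
  by rewrite Fk /divv (count_memPn xD) expr0 divr1.
have nbeat : ~ beaten E Ds xs.
  move=> [p1 [q1 [l1 [adm1 lim1 l11]]]].
  have := maxF _ _ _ adm1 lim1; rewrite lk leNgt (le_lt_trans _ l11) //.
  have := le1 e Ee; rewrite Fk => k1; rewrite -lecR (le_trans _ k1) //.
  by rewrite (le_trans _ (normc_ge_Re k)) // lecR ler_norm.
(* Index 0 stands for [xs]: a coincidence of gaps with [i = 0] is met by a simple pole, any other by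
   a pair. *)
have main i j : (i < j < (size Ds).+1)%N ->
    ~ same_gap E (nth None (xs :: Ds) i) (nth None (xs :: Ds) j).
  case: j => [|j]; rewrite ?andbF //= !ltnS => /andP[ij jD].
  have cjD : nth None Ds j \in Ds by apply: mem_nth.
  move=> sg; apply: nbeat; case: i ij sg => [|i] ij sg.
    have xc : xs <> nth None Ds j by move=> xc; move: xD; rewrite xc cjD.
    case: (same_gap_side (same_gapC sg) xc) => side.
      apply: (@beaten_simple E Ds xs _ 1 cE cjD) => //; [exact: DsE|by left|].
      by move=> z Ez; rewrite !mul1r side.
    apply: (@beaten_simple E Ds xs _ (-1) cE cjD) => //; [exact: DsE|by right|].
    by move=> z Ez; rewrite !mulN1r ltrN2 side.
  apply: (beaten_pair cE _ sg) => // z /=; rewrite addn0.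
  (* Position [i] falls in the first [j] entries, so cutting [Ds] at [j] counts both occurrences
     even if the two points coincide. *)
  rewrite -[in leqRHS](cat_take_drop j Ds) (drop_nth None jD) count_cat /= addnA.
  rewrite (leq_trans _ (leq_addr _ _)) // leq_add2r; case: eqP => // <-.
  by rewrite -has_count has_pred1 -(nth_take None ij) mem_nth // size_take jD.
move=> i j iD jD /eqP; rewrite neq_ltn => /orP[ij|ji]; first by apply: main; rewrite ij.
by move=> /same_gapC; apply: main; rewrite ji.
Qed.

(** * Lagrange interpolation on the projective line *)

(** A zero at infinity is the vanishing of the coefficient of degree [n]. It lowers the size bound
    by one, which makes up for the missing finite root. *)
Lemma proj_roots_eq0 n (s : seq (option R)) P : uniq s -> size s = n.+1 ->
  (size P <= n.+1)%N -> (forall z, z \in s -> hval n P z = 0) -> P = 0.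
Proof.
move=> us ss sP Ps.
apply: (@roots_geq_poly_eq0 _ P (map toC (pmap id s))).
- apply/allP => _ /mapP[x xs ->]; rewrite rootE; apply/eqP; apply: (Ps (Some x)).
  by move: xs; rewrite mem_pmap => /mapP[z zs ->].
- by rewrite map_inj_uniq => [|x y []] //; apply: (pmap_uniq (g := Some)) => // -[].
- rewrite size_map; have := size_pmap_id s; rewrite ss.
  rewrite (count_uniq_mem None us); case: (boolP (None \in s)) => [/Ps /= Pn|_].
    rewrite addn1 => -[->]; rewrite leqNgt; apply/negP => lt.
    have sPn : size P = n.+1 by apply/eqP; rewrite eqn_leq sP lt.
    have : lead_coef P = 0 by rewrite lead_coefE sPn.
    by move/eqP; rewrite lead_coef_eq0 => /eqP P0; rewrite P0 size_poly0 in sPn.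
  by rewrite addn0 => ->.
Qed.

Section Lagrange.
Variables (n : nat) (e : 'I_n.+1 -> option R).
Hypothesis e_inj : injective e.

Lemma eval_at_nodes_inj P Q : (size P <= n.+1)%N -> (size Q <= n.+1)%N ->
  (forall j, hval n P (e j) = hval n Q (e j)) -> P = Q.
Proof.
move=> sP sQ PQ; apply/eqP; rewrite -subr_eq0; apply/eqP.
apply: (@proj_roots_eq0 n (map e (enum 'I_n.+1))).
- by rewrite map_inj_uniq ?enum_uniq.
- by rewrite size_map size_enum_ord.
- by rewrite (leq_trans (size_polyD _ _)) // size_polyN geq_max sP.
- by move=> _ /mapP[j _ ->]; rewrite hvalD hvalN PQ subrr.
Qed.

(** The basis form [L j] is the product of the linear forms at the other nodes; brackets allow a
    node at infinity. *)
Lemma lagrange P x : (size P <= n.+1)%N ->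
  hval n P x = \sum_j hval n P (e j) *
    (\prod_(k < n) (br x (e (lift j k)) / br (e j) (e (lift j k))))%:C.
Proof.
move=> sP.
pose L (j : 'I_n.+1) := \prod_(k <- enum 'I_n) lin (e (lift j k)).
have sL j : (size (L j) <= n.+1)%N.
  by rewrite -[in leqRHS](size_enum_ord n); apply: size_prod_lin => k; exact: size_lin.
have hL j z : hval n (L j) z = (\prod_(k < n) br z (e (lift j k)))%:C.
  rewrite -[X in hval X](size_enum_ord n) hval_prod_lin => [|k]; last exact: size_lin.
  by rewrite big_enum rmorph_prod; apply: eq_bigr => k _; rewrite hval1_lin.
have Lj0 j : \prod_(k < n) br (e j) (e (lift j k)) != 0.
  apply/prodf_neq0 => k _; rewrite br_eq0 (inj_eq e_inj).
  by have := neq_lift j k.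
pose T := \sum_j (hval n P (e j) / (\prod_(k < n) br (e j) (e (lift j k)))%:C) *: L j.
have PT : P = T.
  apply: eval_at_nodes_inj => // [|i].
    apply: (leq_trans (size_sum _ _ _)); apply/bigmax_leqP => j _.
    exact: leq_trans (size_scale_leq _ _) (sL j).
  rewrite /T hval_sum (bigD1 i) //= [X in _ + X]big1 => [|j ji].
    by rewrite addr0 hvalZ hL divfK // fmorph_eq0.
  have [k ik _] := unlift_some ji.
  have /eqP z0 : \prod_(k < n) br (e i) (e (lift j k)) == 0.
    by apply/prodf_eq0; exists k => //; rewrite br_eq0 -ik.
  by rewrite hvalZ hL z0 mulr0.
rewrite [in LHS]PT hval_sum; apply: eq_bigr => j _.
by rewrite hvalZ hL prodf_div rmorphM fmorphV mulrA mulrAC.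
Qed.

End Lagrange.

Lemma unit_disk_Re1 (z : R[i]) : `|z| <= 1 -> 1 <= complex.Re z -> z = 1.
Proof.
case: z => a b /= le1 a1.
have : `|a +i* b| ^+ 2 <= 1 by rewrite expr_le1.
rewrite -add_Re2_Im2 -[1]/(1%:C) lecR /= => ab1.
have [a_1 b_0] : a = 1 /\ b ^+ 2 = 0.
  by have := sqr_ge0 b; split; nra.
by move/eqP: b_0; rewrite sqrf_eq0 a_1 => /eqP ->.
Qed.

(** * Quadrature at interlacing nodes *)

Section Interlacing.
Variables (E : option R -> Prop) (s : seq (option R)) (xs : option R).
Let n := size s.
Let c (k : 'I_n) := nth None s k.
Let w := wc xs.
Variable e : 'I_n.+1 -> option R.
Hypotheses (nEx : ~ E xs) (xsD : xs \notin s).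
Hypothesis (Ee : forall j, E (e j)).
Hypothesis (sE : forall z, z \in s -> ~ E z).
(** Both families are indexed from 0: the order is [e 0], [c 0], [e 1], ..., [c (n-1)], [e n]. *)
Hypothesis c_lt_e : forall (j : 'I_n.+1) (k : 'I_n), (k < j)%N -> w (c k) < w (e j).
Hypothesis e_lt_c : forall (j : 'I_n.+1) (k : 'I_n), (j <= k)%N -> w (e j) < w (c k).

Lemma e_lt (i j : 'I_n.+1) : (i < j)%N -> w (e i) < w (e j).
Proof.
move=> ij; have iN : (i < n)%N by rewrite (leq_trans ij) // -ltnS.
exact: lt_trans (@e_lt_c i (Ordinal iN) (leqnn _)) (@c_lt_e j (Ordinal iN) ij).
Qed.

Lemma e_inj : injective e.
Proof.
move=> i j eij; apply: ord_inj; apply/eqP; rewrite eqn_leq.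
by apply/andP; split; rewrite leqNgt; apply/negP => /e_lt; rewrite eij ltxx.
Qed.

(** The Lagrange coefficient lambda_j. The node paired with [c k] is the [k]-th one after [e j] is
    left out. *)
Definition weight (j : 'I_n.+1) : R :=
  \prod_(k < n) ((w (e j) - w (c k)) / (w (e j) - w (e (lift j k)))).

(** Since [lift j] skips [j], the points [c k] and [e (lift j k)] lie on the same side of [e j], and
    every factor is positive. *)
Lemma weight_gt0 j : 0 < weight j.
Proof.
apply: prodr_gt0 => k _; have [kj|jk] := ltnP k j.
  have lk : (lift j k < j)%N by rewrite /= /bump (ltn_geF kj).
  by rewrite divr_gt0 // subr_gt0 ?c_lt_e ?e_lt.
have lk : (j < lift j k)%N by rewrite /= /bump jk.
by rewrite -mulrNN -invrN divr_gt0 // opprB subr_gt0 ?e_lt_c ?e_lt.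
Qed.

Lemma quadrature P : (size P <= n.+1)%N ->
  hval n P xs / hval n (linprod s) xs =
  \sum_j (weight j)%:C * (hval n P (e j) / hval n (linprod s) (e j)).
Proof.
move=> sP; rewrite (lagrange e_inj xs sP) mulr_suml; apply: eq_bigr => j _.
have linE z : hval n (linprod s) z = (\prod_(k < n) br z (c k))%:C.
  by rewrite hval_linprod (big_nth None) big_mkord.
have ex i : e i <> xs by move=> ex; apply: nEx; rewrite -ex.
have cx k : c k <> xs by move=> cx; move: xsD; rewrite -cx mem_nth.
(* The relation [br_wc] based at [xs] turns brackets into differences of coordinates; the brackets
   with [xs] cancel factor by factor. *)
have key : (\prod_(k < n) (br xs (e (lift j k)) / br (e j) (e (lift j k)))) /
    \prod_(k < n) br xs (c k) = weight j / \prod_(k < n) br (e j) (c k).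
  rewrite -!prodf_div; apply: eq_bigr => k _.
  have lj : w (e j) - w (e (lift j k)) != 0.
    rewrite subr_eq0; apply/eqP => /(wc_inj (ex _) (ex _)) /e_inj.
    by move/eqP; rewrite (negbTE (neq_lift j k)).
  have kj : w (e j) - w (c k) != 0.
    rewrite subr_eq0; apply/eqP => /(wc_inj (ex _) (cx _)) ec.
    by apply: (sE (mem_nth None (ltn_ord k))); rewrite -/(c k) -ec.
  have b0 z : z <> xs -> br xs z != 0 /\ br z xs != 0.
    by move=> zx; rewrite !br_eq0; split; apply/eqP => // ?; apply: zx.
  have [b1 b2] := b0 _ (ex j); have [b3 _] := b0 _ (cx k).
  have [b4 _] := b0 _ (ex (lift j k)).
  rewrite (br_wc (ex j) (cx k)) (br_wc (ex j) (ex (lift j k))) -/w.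
  by field; rewrite lj kj b2 b3 b4 wsign_neq0.
rewrite !linE -mulrA -[X in _ * X]fmorph_div key fmorph_div.
by rewrite mulrCA.
Qed.

Lemma extremal_const p q l : is_ratfun p q -> in_L s p q ->
  (forall z, E z -> `|rval p q z| <= 1) ->
  has_lim (fun x => rval p q (Some x)) xs l -> 1 <= complex.Re l -> p = q.
Proof.
move=> pq inL le1 liml l1; have [P sP ePQ] := in_L_repr pq inL.
have eD j : e j \notin s by apply/negP => /sE; apply; exact: Ee.
have valE j := rval_form pq ePQ sP (eD j).
have lE : l = \sum_j (weight j)%:C * rval p q (e j).
  rewrite (has_lim_unique liml (lim_form pq ePQ sP xsD)) quadrature //.
  by apply: eq_bigr => j _; rewrite valE.
(* The quadrature formula for the constant function 1, whose numerator is [linprod s]. *)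
have sum1 : \sum_j weight j = 1.
  have := quadrature (size_linprod s); rewrite divff ?hval_linprod_neq0 // => /esym.
  under eq_bigr do rewrite divff ?hval_linprod_neq0 // mulr1.
  by rewrite -rmorph_sum => /(congr1 (@complex.Re R)).
have ReE (r : R) (z : R[i]) : complex.Re (r%:C * z) = r * complex.Re z.
  by case: z => a b /=; rewrite mul0r subr0.
have Re_sum : complex.Re l = \sum_j weight j * complex.Re (rval p q (e j)).
  rewrite lE; elim/big_rec2: _ => [//|j x y _ <-].
  by rewrite -ReE; case: (_ * _); case: y.
have Re_le1 j : complex.Re (rval p q (e j)) <= 1.
  rewrite -lecR (le_trans _ (le1 _ (Ee j))) // (le_trans _ (normc_ge_Re _)) //.
  by rewrite lecR ler_norm.
(* These nonnegative terms add up to [1 - Re l], which is at most 0. *)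
have zero : forall j, weight j * (1 - complex.Re (rval p q (e j))) = 0.
  have ge0 j : 0 <= weight j * (1 - complex.Re (rval p q (e j))).
    by rewrite mulr_ge0 ?subr_ge0 // ltW // weight_gt0.
  have sum0 : \sum_j weight j * (1 - complex.Re (rval p q (e j))) = 0.
    apply/eqP; rewrite eq_le sumr_ge0 // andbT.
    under eq_bigr do rewrite mulrBr mulr1.
    by rewrite sumrB sum1 -Re_sum subr_le0.
  by move=> j; apply: (psumr_eq0P (fun i _ => ge0 i) sum0).
have val1 j : rval p q (e j) = 1.
  apply: unit_disk_Re1; first exact: le1.
  have /eqP := zero j; rewrite mulf_eq0 gt_eqF ?weight_gt0 //= subr_eq0.
  by move/eqP <-.
have PQ : P = linprod s.
  apply: (eval_at_nodes_inj e_inj sP (size_linprod s)) => j.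
  by have := val1 j; rewrite valE => /divr1_eq.
by move: ePQ; rewrite PQ mulrC => /(mulfI (linprod_neq0 s)).
Qed.

End Interlacing.

(** * Distinct gaps force the constant 1 *)

(** In the coordinate with pole [xs], if E had no point below or none above some point of [s], that
    point would share the gap of [xs]; if E had none between two neighbours, these would share a
    gap. *)
Lemma exists_interlacing E s xs : ~ E xs -> (forall z, z \in s -> ~ E z) ->
  xs \notin s -> uniq s -> (0 < size s)%N ->
  sorted (fun a b => wc xs a <= wc xs b) s ->
  (forall a, a \in s -> ~ same_gap E xs a) ->
  (forall a b, a \in s -> b \in s -> a <> b -> ~ same_gap E a b) ->
  exists e : 'I_(size s).+1 -> option R, forall j, [/\ E (e j),
    forall k : 'I_(size s), (k < j)%N -> wc xs (nth None s k) < wc xs (e j) &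
    forall k : 'I_(size s), (j <= k)%N -> wc xs (e j) < wc xs (nth None s k)].
Proof.
move=> nEx sE xD us s0 srt gx gs; pose w := wc xs; pose c := nth None s.
have cs k : (k < size s)%N -> c k \in s by move=> ks; apply: mem_nth.
have ax a : a \in s -> a <> xs by move=> aD ax; rewrite ax (negbTE xD) in aD.
have ex z : E z -> z <> xs by move=> Ez zx; apply: nEx; rewrite -zx.
have wE z a : E z -> a \in s -> w z != w a.
  move=> Ez aD; apply/eqP => /(wc_inj (ex z Ez) (ax a aD)) za.
  by apply: (sE a aD); rewrite -za.
have mono i k : (i <= k)%N -> (k < size s)%N -> w (c i) <= w (c k).
  move=> ik ks; apply: (sorted_leq_nth _ _ None srt) => //.
  - by move=> y x z; exact: le_trans.
  - by rewrite inE (leq_ltn_trans ik ks).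
(* As [s] is sorted, each node need only be compared with its neighbours in [s]; the guards drop the
   missing neighbour at either end. *)
suff /fin_all_exists [e eP] (j : 'I_(size s).+1) : exists z, [/\ E z,
    (0 < j)%N -> w (c j.-1) < w z & (j < size s)%N -> w z < w (c j)].
  exists e => j; have [Ej lj rj] := eP j; split=> // k kj.
    have j0 := leq_ltn_trans (leq0n k) kj.
    apply: le_lt_trans (lj j0); apply: mono; first by rewrite -ltnS prednK.
    by have := ltn_ord j; rewrite -[X in (X < _)%N](prednK j0) ltnS.
  by apply: lt_le_trans (rj (leq_ltn_trans kj (ltn_ord k))) _; apply: mono.
have below a : a \in s -> exists2 z, E z & w z < w a.
  move=> aD; apply: NNPP => H; apply: (gx a aD).
  apply: side_same_gap => //; [exact: sE|exact: ax|right=> z Ez].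
  rewrite lt_neqAle eq_sym wE //= leNgt; apply/negP => lt; apply: H; by exists z.
have above a : a \in s -> exists2 z, E z & w a < w z.
  move=> aD; apply: NNPP => H; apply: (gx a aD).
  apply: side_same_gap => //; [exact: sE|exact: ax|left=> z Ez].
  rewrite lt_neqAle wE //= leNgt; apply/negP => lt; apply: H; by exists z.
case: j => -[|j] jn /=.
  by have [z Ez zc] := below _ (cs 0 s0); exists z.
have js : (j < size s)%N by [].
have [jn'|nj] := ltnP j.+1 (size s); last first.
  by have [z Ez zc] := above _ (cs j js); exists z.
have ne : c j <> c j.+1.
  by move/eqP; rewrite nth_uniq // -[X in X == _]addn0 -addn1 eqn_add2l.
apply: NNPP => H; apply: (gs _ _ (cs j js) (cs _ jn') ne).
have lt : w (c j) < w (c j.+1).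
  rewrite lt_neqAle mono // andbT; apply/eqP => /wc_inj e.
  by apply: ne; apply: e; apply: ax; apply: cs.
apply: (between_same_gap (b := xs)) lt; try (exact/sE/cs); try exact/ax/cs.
by move=> z Ez /andP[z1 z2]; apply: H; exists z.
Qed.

Lemma gaps_const E Ds xs p q : ext_compact E -> (0 < size Ds)%N ->
  (forall z, z \in xs :: Ds -> ~ E z) ->
  (forall i j, (i < (size Ds).+1)%N -> (j < (size Ds).+1)%N -> i <> j ->
     ~ same_gap E (nth None (xs :: Ds) i) (nth None (xs :: Ds) j)) ->
  is_extremal E Ds xs p q -> p = q.
Proof.
move=> cE D0 DE gaps [[pq [inL le1]] [l [liml maxl]]].
have nEx : ~ E xs by apply: DE; rewrite inE eqxx.
have sE z : z \in Ds -> ~ E z by move=> zD; apply: DE; rewrite inE zD orbT.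
(* Two equal entries outside E would share a gap. *)
have usx : uniq (xs :: Ds).
  apply/(uniqP None) => i j; rewrite !inE => iD jD eij; apply/eqP/negPn/negP => /eqP ij.
  by apply: (gaps i j iD jD ij); rewrite eij; apply/same_gap_refl/DE/mem_nth.
have gp a b : a \in xs :: Ds -> b \in xs :: Ds -> a <> b -> ~ same_gap E a b.
  move=> aD bD ab; rewrite -(nth_index None aD) -(nth_index None bD).
  apply: gaps; rewrite -?[(size Ds).+1]/(size (xs :: Ds)) ?index_mem //.
  by move/(congr1 (nth None (xs :: Ds))); rewrite !nth_index.
have /andP[xD uD] := usx.
set s := sort (fun a b => wc xs a <= wc xs b) Ds.
have ss : s =i Ds by move=> z; rewrite mem_sort.
have [e eP] : exists e : 'I_(size s).+1 -> option R, forall j, [/\ E (e j),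
    forall k : 'I_(size s), (k < j)%N -> wc xs (nth None s k) < wc xs (e j) &
    forall k : 'I_(size s), (j <= k)%N -> wc xs (e j) < wc xs (nth None s k)].
  apply: exists_interlacing; rewrite ?ss ?sort_uniq ?size_sort //.
  - by move=> z; rewrite ss; exact: sE.
  - by apply: sort_sorted => a b; exact: le_total.
  - move=> a; rewrite ss => aD; apply: gp; rewrite ?inE ?eqxx ?aD ?orbT //.
    by move=> xa; rewrite xa aD in xD.
  - by move=> a b; rewrite !ss => aD bD; apply: gp; rewrite inE ?aD ?bD orbT.
have d0 : divv Ds xs = 0%N by apply/count_memPn.
have one : is_ratfun (1 : {poly R[i]}) 1 by split; rewrite ?oner_eq0 ?coprimep1.
have val1 z : rval (1 : {poly R[i]}) 1 z = 1.
  by rewrite -[X in rval X](scale1r 1) ratfun_const // scale1r.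
apply: (extremal_const (E := E) (s := s) (xs := xs) (e := e)) => //.
- by rewrite ss.
- by move=> j; have [] := eP j.
- by move=> z; rewrite ss; exact: sE.
- by move=> j; have [] := eP j.
- by move=> j; have [] := eP j.
- by apply: in_L_sub inL => z; rewrite count_sort.
- by apply: has_lim_ext liml => x _ _; rewrite d0 expr0 divr1.
(* The constant 1 is a competitor, so the extremal value has real part at least 1. *)
- apply: (maxl 1 1 1).
    split=> //; split=> [z|z _]; last by rewrite val1 normr1.
    rewrite /pole_ord oner_eq0; case: z => [x|]; by rewrite subnn.
  by apply: has_lim_ext (has_lim_const 1 xs) => x _ _; rewrite val1 d0 expr0 divr1.
Qed.

End Extremal.

Theorem theorem1p2 (R : rcfType) (E : option R -> Prop) (n : nat)
  (Ds : seq (option R)) (xs : option R) (p q : {poly R[i]}) :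
  ext_compact E -> ext_proper E -> ext_infinite E ->
  (0 < n)%N -> size Ds = n -> (forall z, z \in Ds -> ~ E z) -> ~ E xs ->
  is_extremal E Ds xs p q ->
  ((exists c : R[i], p = c *: q) <->
   exists cs : seq (option R),
     [/\ size cs = n,
         (forall z, divv Ds z = count_mem z cs),
         (forall z, z \in xs :: cs -> ~ E z) &
         (forall i j, (i < n.+1)%N -> (j < n.+1)%N -> i <> j ->
            ~ same_gap E (nth None (xs :: cs) i) (nth None (xs :: cs) j))]).
Proof.
move=> cE _ iE n0 sD DsE nEx ext; split=> [const|[cs [scs cnt csE gaps]]].
  exists Ds; split=> // [z|i j].
    by rewrite inE => /orP[/eqP ->|/DsE].
  by rewrite -sD; apply: (const_gaps cE iE DsE nEx ext const).
(* Admissibility depends only on multiplicities, so [Ds] and its rearrangement [cs] pose the same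
   extremal problem. *)
have adm p' q' : admissible E Ds p' q' <-> admissible E cs p' q'.
  by split=> -[pq [inL le1]]; split=> //; split=> //;
    apply: in_L_sub inL => z; rewrite -[count_mem z cs]cnt.
exists 1; rewrite scale1r.
apply: (@gaps_const R E cs xs p q cE); rewrite ?scs //.
have [admpq [l [liml maxl]]] := ext; split; first exact/adm.
exists l; rewrite /functional_lim -[divv cs xs]cnt; split=> // p' q' l' /adm.
exact: maxl.
Qed.
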